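(* Let $\mathbf{k}$ be an ordered field, $\lambda\in\mathbf{k}$ nonzero, $(\mathfrak{g},[\cdot,\cdot,\cdot])$ a $3$-Lie algebra over $\mathbf{k}$ with $[\mathfrak{g},\mathfrak{g},\mathfrak{g}]\subset\mathcal{C}(\mathfrak{g})$, and $R$ a modified Rota-Baxter operator of weight $\lambda$ on $\mathfrak{g}$. (1) If a linear map $\hat R:\mathfrak{g}\to\mathfrak{g}$ generates a linear deformation of $R$, then $\hat R$ is a $1$-cocycle of the $3$-Lie algebra $(\mathfrak{g},[\cdot,\cdot,\cdot]_R)$ with coefficients in the representation $(\mathfrak{g},\rho_R)$. (2) If $R^1_t=R+t\hat R_1$ and $R^2_t=R+t\hat R_2$ are equivalent linear deformations of $R$, generated by $\hat R_1$ and $\hat R_2$ respectively, then $\hat R_1$ and $\hat R_2$ belong to the same cohomology class in $H^2_R(\mathfrak{g})$.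
   Context: A $3$-Lie algebra is a vector space with a skew-symmetric trilinear bracket satisfying $[x,y,[u,v,w]]=[[x,y,u],v,w]+[u,[x,y,v],w]+[u,v,[x,y,w]]$; its center is $\mathcal{C}(\mathfrak{g})=\{x:[x,y,z]=0\ \forall y,z\}$. A modified Rota-Baxter operator of weight $\lambda$ on $\mathfrak{g}$ is a linear map $R:\mathfrak{g}\to\mathfrak{g}$ such that for all $x,y,z$ $$[Rx,Ry,Rz]=R\big([Rx,Ry,z]+[x,Ry,Rz]+[Rx,y,Rz]+\lambda[x,y,z]\big)-\lambda[Rx,y,z]-\lambda[x,Ry,z]-\lambda[x,y,Rz].$$ Put $[x,y,z]_R=[Rx,Ry,z]+[x,Ry,Rz]+[Rx,y,Rz]+\lambda[x,y,z]$ (a $3$-Lie bracket under the assumption $[\mathfrak{g},\mathfrak{g},\mathfrak{g}]\subset\mathcal{C}(\mathfrak{g})$) and $\rho_R(x,y)z=[Rx,Ry,z]-R([Rx,y,z]+[x,Ry,z])+\lambda[x,y,z]$ (a representation of $(\mathfrak{g},[\cdot,\cdot,\cdot]_R)$ on $\mathfrak{g}$). A linear map $h:\mathfrak{g}\to\mathfrak{g}$ is a $1$-cocycle if $\rho_R(y,z)h(x)+\rho_R(z,x)h(y)+\rho_R(x,y)h(z)=h([x,y,z]_R)$ for all $x,y,z$. For $\mathfrak{X}=a\wedge b\in\wedge^2\mathfrak{g}$ write $[\mathfrak{X},x]=\mathrm{ad}_{\mathfrak{X}}x=[a,b,x]$ (extended linearly in $\mathfrak{X}$), and $d_R(\mathfrak{X})x=R[\mathfrak{X},x]-[\mathfrak{X},Rx]$;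 each $d_R(\mathfrak{X})$ is a $1$-cocycle. $H^2_R(\mathfrak{g})$ is the quotient of the space of $1$-cocycles, i.e. of linear maps $h:\mathfrak{g}\to\mathfrak{g}$ satisfying $\rho_R(y,z)h(x)+\rho_R(z,x)h(y)+\rho_R(x,y)h(z)=h([x,y,z]_R)$ for all $x,y,z\in\mathfrak{g}$ (the degree-2 cocycles of the complex of the operator $R$, whose degree-1 term is $\wedge^2\mathfrak{g}$ with differential $d_R$), by $\{d_R(\mathfrak{X}):\mathfrak{X}\in\wedge^2\mathfrak{g}\}$. $\hat R$ generates a linear deformation of $R$ if there is $\epsilon>0$ in $\mathbf{k}$ such that $R_t=R+t\hat R$ is a modified Rota-Baxter operator of weight $\lambda$ on $\mathfrak{g}$ for all $t\in(-\epsilon,\epsilon)$. Two linear deformations $R^1_t,R^2_t$ are equivalent if there is $\mathfrak{X}\in\wedge^2\mathfrak{g}$ such that, for these $t$, $\varphi_t=\mathrm{id}+t\,\mathrm{ad}_{\mathfrak{X}}$ satisfies (a) $\varphi_t([x,y,z])=[\varphi_t x,\varphi_t y,\varphi_t z]$ for all $x,y,z$, and (b) $R^2_t\circ\varphi_t=\varphi_t\circ R^1_t$. *)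

(* Defs.v *)
From HB Require Import structures.
From mathcomp Require Import all_boot all_order all_algebra.
From mathcomp Require Import generic_quotient ring_quotient.
From mathcomp Require Import boolp classical_sets.
From mathcomp Require Import freeg.

Set Implicit Arguments.
Unset Strict Implicit.
Unset Printing Implicit Defensive.

Import Order.TTheory GRing.Theory Num.Theory.

Local Open Scope ring_scope.
Local Open Scope quotient_scope.
Local Open Scope classical_set_scope.

(* The exterior square of V: the free vector space on V * V modulo the
   subspace spanned by the bilinearity and alternation relators. *)
Section ExteriorSquare.
Context (k : fieldType) (V : lmodType k).

Local Notation fr := {freeg (V * V)%type / k}.

Inductive ext2_relator : fr -> Prop :=
| ext2_rel_linl (c : k) (a b d : V) :
    ext2_relator (<<(c *: a + b, d)>> - c *: <<(a, d)>> - <<(b, d)>>)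
| ext2_rel_linr (c : k) (a b d : V) :
    ext2_relator (<<(d, c *: a + b)>> - c *: <<(d, a)>> - <<(d, b)>>)
| ext2_rel_alt (a : V) : ext2_relator <<(a, a)>>.

Inductive ext2_null : fr -> Prop :=
| ext2_null_gen (D : fr) : ext2_relator D -> ext2_null D
| ext2_null0 : ext2_null 0
| ext2_null_lin (c : k) (D E : fr) :
    ext2_null D -> ext2_null E -> ext2_null (c *: D + E).

Definition ext2_nulls : {pred fr} := [pred D | `[< ext2_null D >]].

Fact ext2_nulls_submod_closed : submod_closed ext2_nulls.
Proof.
split=> [|c D E /asboolP nD /asboolP nE]; apply/asboolP.
  exact: ext2_null0.
exact: ext2_null_lin.
Qed.

HB.instance Definition _ :=
  GRing.isSubmodClosed.Build k fr ext2_nulls ext2_nulls_submod_closed.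

Definition ext2 : Type := Quotient.quot ext2_nulls.

HB.instance Definition _ := GRing.Zmodule.on ext2.

Definition ext2_pi (D : fr) : ext2 := \pi_(Quotient.quot ext2_nulls) D.
Definition ext2_repr (X : ext2) : fr := @repr _ (Quotient.quot ext2_nulls) X.

Lemma ext2_reprK (X : ext2) : ext2_pi (ext2_repr X) = X.
Proof. exact: (@reprK _ (Quotient.quot ext2_nulls)). Qed.

Lemma ext2_pi_eq (D E : fr) : ext2_pi D = ext2_pi E <-> ext2_null (D - E).
Proof.
rewrite /ext2_pi; split=> [/eqP|nDE].
  by rewrite -Quotient.idealrBE => /asboolP.
by apply/eqP; rewrite -Quotient.idealrBE; apply/asboolP.
Qed.

Lemma ext2_pi_add (D E : fr) : ext2_pi (D + E) = ext2_pi D + ext2_pi E.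
Proof. by rewrite /ext2_pi; exact: Quotient.pi_add. Qed.

Definition ext2_scale (c : k) (X : ext2) : ext2 := ext2_pi (c *: ext2_repr X).

Lemma ext2_pi_scale (c : k) (D : fr) :
  ext2_pi (c *: D) = ext2_scale c (ext2_pi D).
Proof.
apply/ext2_pi_eq; rewrite -scalerBr -[_ *: _]addr0.
apply: ext2_null_lin; last exact: ext2_null0.
by apply/ext2_pi_eq; rewrite ext2_reprK.
Qed.

Fact ext2_scaleA (c d : k) (X : ext2) :
  ext2_scale c (ext2_scale d X) = ext2_scale (c * d) X.
Proof. by rewrite -[X]ext2_reprK -!ext2_pi_scale scalerA. Qed.

Fact ext2_scale1 : left_id 1 ext2_scale.
Proof. by move=> X; rewrite -[X]ext2_reprK -!ext2_pi_scale scale1r. Qed.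

Fact ext2_scaleDr : right_distributive ext2_scale +%R.
Proof.
move=> c X Y; rewrite -[X]ext2_reprK -[Y]ext2_reprK.
by rewrite -ext2_pi_add -!ext2_pi_scale -ext2_pi_add scalerDr.
Qed.

Fact ext2_scaleDl (X : ext2) : {morph ext2_scale^~ X : c d / c + d}.
Proof.
move=> c d; rewrite -[X]ext2_reprK.
by rewrite -!ext2_pi_scale -ext2_pi_add scalerDl.
Qed.

HB.instance Definition _ := GRing.Zmodule_isLmodule.Build k ext2
  ext2_scaleA ext2_scale1 ext2_scaleDr ext2_scaleDl.

Fact ext2_pi_is_linear : linear ext2_pi.
Proof. by move=> c D E; rewrite ext2_pi_add ext2_pi_scale. Qed.

Definition wedge (a b : V) : ext2 := ext2_pi <<(a, b)>>.

Section Lift.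
Context (W : lmodType k) (f : V -> V -> W).

(* Linear extension of (a /\ b |-> f a b).  It goes through a representative,
   hence is meaningful only for f bilinear and alternating (ext2_lift_wedge,
   ext2_lift_linear). *)
Definition ext2_lift (X : ext2) : W :=
  fglift (fun p : V * V => f p.1 p.2) (ext2_repr X).

Hypothesis f_linl : forall b, linear (f^~ b).
Hypothesis f_linr : forall a, linear (f a).
Hypothesis f_alt : forall a, f a a = 0.

Let F := fglift (fun p : V * V => f p.1 p.2).

Let FB : {morph F : D E / D - E}.
Proof. exact: lift_is_additive. Qed.

Let F0 : F 0 = 0. Proof. by rewrite -(subrr 0) FB subrr. Qed.

Let FD : {morph F : D E / D + E}.
Proof. by move=> D E; rewrite -[E in LHS]opprK FB -[- E]sub0r FB F0 sub0r opprK. Qed.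

Let FU (c : k) (p : V * V) : F << c *g p >> = c *: f p.1 p.2.
Proof. by rewrite /F liftU. Qed.

Let FZ (c : k) (D : fr) : F (c *: D) = c *: F D.
Proof.
have -> : c *: D = \sum_(p <- dom D) << c * coeff p D *g p >> by [].
rewrite -[D in RHS]freeg_sumE !(big_morph F FD F0) scaler_sumr.
by apply: eq_bigr => p _; rewrite !FU scalerA.
Qed.

Let F_null (D : fr) : ext2_null D -> F D = 0.
Proof.
elim=> [E [c a b d|c a b d|a]||c E E' _ IHE _ IHE'].
- by rewrite !FB FZ !FU !scale1r /= f_linl addrAC addrK subrr.
- by rewrite !FB FZ !FU !scale1r /= f_linr addrAC addrK subrr.
- by rewrite FU f_alt scaler0.
- exact: F0.
- by rewrite FD FZ IHE IHE' scaler0 addr0.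
Qed.

Lemma ext2_lift_pi (D : fr) : ext2_lift (ext2_pi D) = F D.
Proof.
apply/eqP; rewrite -subr_eq0 -FB; apply/eqP/F_null/ext2_pi_eq.
exact: ext2_reprK.
Qed.

Lemma ext2_lift_wedge (a b : V) : ext2_lift (wedge a b) = f a b.
Proof. by rewrite ext2_lift_pi FU scale1r. Qed.

Lemma ext2_lift_linear : linear ext2_lift.
Proof.
move=> c X Y; rewrite -[X]ext2_reprK -[Y]ext2_reprK -ext2_pi_is_linear.
by rewrite !ext2_lift_pi FD FZ.
Qed.

End Lift.
End ExteriorSquare.

Section ThreeLie.
Context (k : realFieldType).

(* Adjacent transpositions generate S_3, so lie3_skew12 and lie3_skew23 amount
   to skew-symmetry in all three arguments. *)
Record three_lie (g : lmodType k) := ThreeLie {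
  lie3 :> g -> g -> g -> g;
  lie3_lin1 : forall y z, linear (fun x => lie3 x y z);
  lie3_lin2 : forall x z, linear (fun y => lie3 x y z);
  lie3_lin3 : forall x y, linear (fun z => lie3 x y z);
  lie3_skew12 : forall x y z, lie3 x y z = - lie3 y x z;
  lie3_skew23 : forall x y z, lie3 x y z = - lie3 x z y;
  lie3_fundamental : forall x y u v w,
    lie3 x y (lie3 u v w) =
      lie3 (lie3 x y u) v w + lie3 u (lie3 x y v) w + lie3 u v (lie3 x y w)
}.

Context (g : lmodType k) (L : three_lie g).

Definition center : set g := [set x | forall y z, L x y z = 0].

(* The span of all brackets; scalars are absorbed by trilinearity. *)
Definition derived : set g :=
  [set u | exists s : seq (g * g * g), u = \sum_(p <- s) L p.1.1 p.1.2 p.2].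

Definition ad (X : ext2 g) (x : g) : g := ext2_lift (fun a b => L a b x) X.

Lemma lie3_alt12 (a x : g) : L a a x = 0.
Proof.
have /eqP := lie3_skew12 L a a x.
by rewrite -subr_eq0 opprK -mulr2n -scaler_nat scaler_eq0 pnatr_eq0 => /eqP.
Qed.

Lemma ad_wedge (a b x : g) : ad (wedge a b) x = L a b x.
Proof.
apply: (@ext2_lift_wedge _ _ _ (fun a b => L a b x)).
- by move=> d; exact: lie3_lin1.
- by move=> d; exact: lie3_lin2.
- by move=> d; exact: lie3_alt12.
Qed.

Lemma ad_linear (x : g) : linear (ad^~ x).
Proof.
apply: ext2_lift_linear.
- by move=> d; exact: lie3_lin1.
- by move=> d; exact: lie3_lin2.
- by move=> d; exact: lie3_alt12.
Qed.

Context (lambda : k).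

Definition modified_rota_baxter (R : {linear g -> g}) : Prop :=
  forall x y z,
    L (R x) (R y) (R z) =
      R (L (R x) (R y) z + L x (R y) (R z) + L (R x) y (R z)
         + lambda *: L x y z)
      - lambda *: L (R x) y z - lambda *: L x (R y) z - lambda *: L x y (R z).

Definition bracketR (R : {linear g -> g}) (x y z : g) : g :=
  L (R x) (R y) z + L x (R y) (R z) + L (R x) y (R z) + lambda *: L x y z.

Definition rhoR (R : {linear g -> g}) (x y z : g) : g :=
  L (R x) (R y) z - R (L (R x) y z + L x (R y) z) + lambda *: L x y z.

Definition one_cocycle (br rho : g -> g -> g -> g) (h : {linear g -> g}) :=
  forall x y z, rho y z (h x) + rho z x (h y) + rho x y (h z) = h (br x y z).

Definition dR (R : {linear g -> g}) (X : ext2 g) (x : g) : g :=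
  R (ad X x) - ad X (R x).

Definition Z2R (R : {linear g -> g}) : set {linear g -> g} :=
  [set h | one_cocycle (bracketR R) (rhoR R) h].

Definition B2R (R : {linear g -> g}) : set (g -> g) :=
  [set f | exists X : ext2 g, f = dR R X].

Definition cohomology_class (R h : {linear g -> g}) : set {linear g -> g} :=
  [set h' | Z2R R h' /\ B2R R (fun x => h' x - h x)].

(* The quotient of the cocycles by the coboundaries, as the set of cosets. *)
Definition H2R (R : {linear g -> g}) : set (set {linear g -> g}) :=
  [set cohomology_class R h | h in Z2R R].

Definition deformation (R Rhat : {linear g -> g}) (t : k) : {linear g -> g} :=
  R \+ t \*: Rhat.

Definition deformation_on (e : k) (R Rhat : {linear g -> g}) : Prop :=
  forall t, - e < t < e -> modified_rota_baxter (deformation R Rhat t).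

Definition generates_deformation (R Rhat : {linear g -> g}) : Prop :=
  exists2 e : k, 0 < e & deformation_on e R Rhat.

Definition phi (X : ext2 g) (t : k) (x : g) : g := x + t *: ad X x.

(* The conditions are imposed on a common interval ]-e, e[ on which both
   deformations are defined. *)
Definition equivalent_deformations (R Rhat1 Rhat2 : {linear g -> g}) : Prop :=
  exists e : k,
  [/\ 0 < e, deformation_on e R Rhat1, deformation_on e R Rhat2 &
    exists X : ext2 g, forall t, - e < t < e ->
      (forall x y z,
         phi X t (L x y z) = L (phi X t x) (phi X t y) (phi X t z)) /\
      deformation R Rhat2 t \o phi X t =1 phi X t \o deformation R Rhat1 t].

End ThreeLie.

(* Main.v *)
(** Everything is read off the coefficient of [t]: an identity between
    polynomials in [t] with coefficients in [g] that holds on an interval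
    holds coefficientwise.  The linear coefficient of the modified Rota-Baxter
    identity of [R + t Rhat] is the cocycle condition for [Rhat], and the
    linear coefficient of [R^2_t o phi_t = phi_t o R^1_t] says that
    [Rhat2 - Rhat1] is [dR (- X)]. *)
Require Import Defs.
From HB Require Import structures.
From mathcomp Require Import all_boot all_order all_algebra.
From mathcomp Require Import boolp classical_sets.
From mathcomp Require Import freeg ring lra.

Import Order.TTheory GRing.Theory Num.Theory.
Local Open Scope ring_scope.
Local Open Scope classical_set_scope.

(* The appended 0 makes every summand the left operand of some +. *)
Ltac zmod_ac :=
  rewrite ?opprD ?opprK;
  match goal with |- ?l = ?r => rewrite -[l]addr0 -[r]addr0 end;
  rewrite -?addrA;
  repeat match goal with |- (?a + _)%R = _ =>
    rewrite ?[in RHS](addrCA _ a); apply: (congr1 (+%R a))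
  end; reflexivity.

(** Four values of the cubic inside the interval can be combined into a nonzero multiple of [b]. *)
Lemma cubic_coef1_eq0 (k : realFieldType) (V : lmodType k) (e : k)
    (a b c d : V) :
  0 < e ->
  (forall t, - e < t < e -> a + t *: b + t ^+ 2 *: c + t ^+ 3 *: d = 0) ->
  b = 0.
Proof.
(* With a third of [e] as step, the nodes up to [2 * s] in absolute value stay strictly inside the
   interval. *)
move=> e_gt0 p0; pose s := e / 3; have s_gt0 : 0 < s by rewrite divr_gt0.
have Es : e = 3 * s by rewrite /s; field.
(* Working with coefficient tuples reduces the combination of values to four scalar identities. *)
pose q (w0 w1 w2 w3 : k) := w0 *: a + w1 *: b + w2 *: c + w3 *: d.
have qD w0 w1 w2 w3 v0 v1 v2 v3 :
    q w0 w1 w2 w3 + q v0 v1 v2 v3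
    = q (w0 + v0) (w1 + v1) (w2 + v2) (w3 + v3).
  by rewrite /q !scalerDl; zmod_ac.
have q0 w t : - e < t < e -> q w (w * t) (w * t ^+ 2) (w * t ^+ 3) = 0.
  by move=> /p0/(congr1 ( *:%R w)); rewrite !scalerDr !scalerA scaler0.
(* The weights 8, -8, -1, 1 at s, -s, 2s, -2s isolate the coefficient of t. *)
have : q 0 (12 * s) 0 0 = 0.
  have -> : q 0 (12 * s) 0 0 =
      q 8 (8 * s) (8 * s ^+ 2) (8 * s ^+ 3)
      + q (- 8) (- 8 * - s) (- 8 * (- s) ^+ 2) (- 8 * (- s) ^+ 3)
      + q (- 1) (- 1 * (2 * s)) (- 1 * (2 * s) ^+ 2) (- 1 * (2 * s) ^+ 3)
      + q 1 (1 * - (2 * s)) (1 * (- (2 * s)) ^+ 2) (1 * (- (2 * s)) ^+ 3).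
    by rewrite !qD; congr (q _ _ _ _); ring.
  by rewrite !q0 ?addr0 // Es; lra.
rewrite /q !scale0r add0r !addr0 => /eqP.
by rewrite scaler_eq0 mulf_eq0 (gt_eqF s_gt0) pnatr_eq0 => /eqP.
Qed.

Section ThreeLieDeformation.
Context (k : realFieldType) (g : lmodType k) (L : three_lie g).

Lemma lie3_line1 a b y z (t : k) : L (a + t *: b) y z = L a y z + t *: L b y z.
Proof. by rewrite addrC (lie3_lin1 L y z) addrC. Qed.

Lemma lie3_line2 a b x z (t : k) : L x (a + t *: b) z = L x a z + t *: L x b z.
Proof. by rewrite addrC (lie3_lin2 L x z) addrC. Qed.

Lemma lie3_line3 a b x y (t : k) : L x y (a + t *: b) = L x y a + t *: L x y b.
Proof. by rewrite addrC (lie3_lin3 L x y) addrC. Qed.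

Lemma lie3_rot x y z : L x y z = L y z x.
Proof. by rewrite lie3_skew12 lie3_skew23 opprK. Qed.

(** [ext2_lift] sums over one fixed representative of [X], so linearity in the last argument passes
    through term by term. *)
Lemma ad_line (X : ext2 g) (t : k) x y :
  ad L X (x + t *: y) = ad L X x + t *: ad L X y.
Proof.
rewrite /ad /ext2_lift; unlock fglift; rewrite /lift /prelift.
rewrite scaler_sumr -big_split; apply: eq_bigr => p _ /=.
by rewrite lie3_line3 scalerDr !scalerA mulrC.
Qed.

Lemma dR_linear (R : {linear g -> g}) x : linear ((dR L R)^~ x).
Proof.
move=> c X Y; rewrite /dR !ad_linear linearP /= scalerBr.
by rewrite opprD addrACA.
Qed.

Lemma dR0 (R : {linear g -> g}) x : dR L R 0 x = 0.
Proof. by have := dR_linear R x (-1) 0 0; rewrite scaler0 addr0 scaleN1r addNr. Qed.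

Lemma dRN (R : {linear g -> g}) (X : ext2 g) x : dR L R (- X) x = - dR L R X x.
Proof. by have := dR_linear R x (-1) X 0; rewrite dR0 !addr0 !scaleN1r. Qed.

Context (lambda : k).

Definition mrb_defect (R : {linear g -> g}) x y z : g :=
  L (R x) (R y) (R z) + lambda *: L x y (R z) + lambda *: L x (R y) z
    + lambda *: L (R x) y z - R (bracketR L lambda R x y z).

Lemma mrb_defect_eq0 (R : {linear g -> g}) :
  modified_rota_baxter L lambda R -> forall x y z, mrb_defect R x y z = 0.
Proof. by move=> HR x y z; rewrite /mrb_defect HR !subrK subrr. Qed.

Definition cocycle_defect (R H : {linear g -> g}) x y z : g :=
  rhoR L lambda R y z (H x) + rhoR L lambda R z x (H y)
    + rhoR L lambda R x y (H z) - H (bracketR L lambda R x y z).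

Lemma mrb_defect_deformation (R H : {linear g -> g}) x y z :
  exists c d, forall t,
    mrb_defect (deformation R H t) x y z =
      mrb_defect R x y z + t *: cocycle_defect R H x y z
        + t ^+ 2 *: c + t ^+ 3 *: d.
Proof.
(* Sorted by the number of occurrences of [H]: two in [c], three in [d]. *)
exists (L (H x) (H y) (R z) + L (H x) (R y) (H z) + L (R x) (H y) (H z)
  - R (L (H x) (H y) z + L x (H y) (H z) + L (H x) y (H z))
  - H (L (H x) (R y) z + L (R x) (H y) z + L x (H y) (R z)
       + L x (R y) (H z) + L (H x) y (R z) + L (R x) y (H z))).
exists (L (H x) (H y) (H z)
  - H (L (H x) (H y) z + L x (H y) (H z) + L (H x) y (H z))) => t.
rewrite /mrb_defect /cocycle_defect /rhoR /bracketR /deformation /=.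
(* Cyclic rotations bring the brackets from [rhoR] into the order [x], [y], [z], so that both sides
   share the same terms. *)
rewrite -(lie3_rot (H x) (R y) (R z)) -(lie3_rot (H x) (R y) z).
rewrite -(lie3_rot (H x) y (R z)) -(lie3_rot (H x) y z).
rewrite (lie3_rot (R z) (R x) (H y)) (lie3_rot (R z) x) (lie3_rot z (R x)).
rewrite (lie3_rot z x).
rewrite !(lie3_line1, lie3_line2, lie3_line3).
rewrite !(linearD, linearN, linearZ) /= !(scalerDr, scalerN, scalerA).
rewrite (exprS t 2) !expr2 !mulrA (mulrC lambda t).
zmod_ac.
Qed.

Lemma deformation_cocycle (R H : {linear g -> g}) :
  modified_rota_baxter L lambda R ->
  generates_deformation L lambda R H ->
  one_cocycle (bracketR L lambda R) (rhoR L lambda R) H.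
Proof.
move=> mrbR [e e_gt0 HR] x y z; apply/eqP; rewrite -subr_eq0; apply/eqP.
have [c [d Ecd]] := mrb_defect_deformation R H x y z.
(* The constant coefficient is the defect of [R] itself, hence [0]. *)
apply: (@cubic_coef1_eq0 _ _ e 0 (cocycle_defect R H x y z) c d) => // t.
move=> /HR/mrb_defect_eq0/(_ x y z).
by rewrite Ecd mrb_defect_eq0.
Qed.

Lemma equivalent_deformations_dR (R H1 H2 : {linear g -> g}) :
  equivalent_deformations L lambda R H1 H2 ->
  exists X : ext2 g, forall x, H2 x - H1 x = dR L R X x.
Proof.
case=> e [e_gt0 _ _ [X eqv]]; exists (- X) => x; rewrite dRN.
apply/eqP; rewrite -subr_eq0 opprK; apply/eqP.
(* The intertwining relation is only quadratic in [t], so the cubic coefficient is [0]. *)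
apply: (@cubic_coef1_eq0 _ _ e 0 _ (H2 (ad L X x) - ad L X (H1 x)) 0) => //.
move=> t /eqv[_ /(_ x)/eqP]; rewrite -subr_eq0 => /eqP.
rewrite /deformation /phi /dR /= !ad_line => E; apply: etrans E.
rewrite scaler0 addr0 add0r !(linearD, linearZ) /=.
rewrite !(scalerDr, scalerN, scalerA) -expr2.
(* The right side still carries [R x] and its opposite; [zmod_ac] only permutes terms, so the same
   pair is inserted on the left. *)
rewrite -[LHS](addrK (R x)).
zmod_ac.
Qed.

End ThreeLieDeformation.

Theorem theorem6p3 (k : realFieldType) (lambda : k) (g : lmodType k)
    (L : three_lie g) (R : {linear g -> g}) :
  lambda != 0 ->
  derived L `<=` center L ->
  modified_rota_baxter L lambda R ->
  (forall Rhat : {linear g -> g},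
     generates_deformation L lambda R Rhat ->
     one_cocycle (bracketR L lambda R) (rhoR L lambda R) Rhat) /\
  (forall Rhat1 Rhat2 : {linear g -> g},
     generates_deformation L lambda R Rhat1 ->
     generates_deformation L lambda R Rhat2 ->
     equivalent_deformations L lambda R Rhat1 Rhat2 ->
     exists2 C, H2R L lambda R C & C Rhat1 /\ C Rhat2).
Proof.
move=> _ _ mrbR; have Z H := deformation_cocycle _ _ _ _ R H mrbR.
split=> // R1 R2 /Z Z1 /Z Z2.
case/equivalent_deformations_dR=> X EX.
(* The common class is that of [R1], which contains [R1] through the zero coboundary and [R2]
   through [X]. *)
exists (cohomology_class L lambda R R1); first by exists R1.
split; split=> //; last by exists X; apply: funext.
by exists 0; apply: funext => x; rewrite subrr dR0.
Qed.
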